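(* Let $G$ be a subgroup of $\mathbb{Z}^{\mathbb{N}}$. The following conditions are equivalent: (1) $G$ is Scheepers-bounded. (2) For each strictly increasing $h\in\mathbb{N}^{\mathbb{N}}$ there is $f\in\mathbb{N}^{\mathbb{N}}$ such that for every finite $F\subseteq G$ there exists $n$ such that for all $g\in F$ and all $k\in[0,h(n))$, $|g(k)|\le f(n)$. (3) For each strictly increasing $h\in\mathbb{N}^{\mathbb{N}}$ there is $f\in\mathbb{N}^{\mathbb{N}}$ such that for every finite $F\subseteq G$ there exists $n$ such that for all $g\in F$ and all $k\in[0,h(n))$, $g(k)\le f(n)$. (4) There is $f\in\mathbb{N}^{\mathbb{N}}$ such that for every finite $F\subseteq G$ there exist infinitely many $n$ such that for all $g\in F$ and all $k\in[0,n)$, $|g(k)|\le f(n)$. (5) There is $f\in\mathbb{N}^{\mathbb{N}}$ such that for every finite $F\subseteq G$ there exist infinitely many $n$ such that for all $g\in F$ and all $k\in[0,n)$, $g(k)\le f(n)$. Moreover, in (2) and (3) the quantifier ''there exists $n$'' can be replaced by ''there exist infinitely many $n$''.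
   Context: $\mathbb{N}=\{0,1,2,\dots\}$, and $[0,m)=\{0,1,\dots,m-1\}$. The group $\mathbb{Z}^{\mathbb{N}}$ (the Baer-Specker group) carries pointwise addition and the product topology ($\mathbb{Z}$ discrete); subgroups carry the subspace topology. A topological group $(G,\cdot)$ is Scheepers-bounded if for each sequence $(U_n)_{n\in\mathbb{N}}$ of neighborhoods of the unit of $G$ there exist finite sets $F_n\subseteq G$, $n\in\mathbb{N}$, such that for each finite set $F\subseteq G$ there is $n$ such that $F\subseteq F_n\cdot U_n$, where $A\cdot B=\{a\cdot b: a\in A,\ b\in B\}$. *)

(* Defs.v *)
From HB Require Import structures.
From mathcomp Require Import all_boot all_order all_algebra.
From mathcomp Require Import all_classical all_reals all_analysis.

Set Implicit Arguments.
Unset Strict Implicit.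
Unset Printing Implicit Defensive.

Import Order.TTheory GRing.Theory Num.Theory.

Local Open Scope classical_set_scope.
Local Open Scope ring_scope.

(* Additive notation: [topologicalZmodType] is the library's class of (abelian)
   topological groups, so the unit is [0] and the group law is [+]. *)
Definition scheepers_bounded (G : topologicalZmodType) : Prop :=
  forall U : nat -> set G, (forall n, nbhs (0 : G) (U n)) ->
  exists F : nat -> set G, (forall n, finite_set (F n)) /\
    forall A : set G, finite_set A ->
      exists n, A `<=` [set a + b | a in F n & b in U n].

(* [discrete_topology int] is [int] with the discrete topology; the group
   structure is the pointwise one of [nat -> int]. *)
Definition baer_specker : Type := nat -> int.

HB.instance Definition _ := GRing.Zmodule.copy baer_specker (nat -> int).
HB.instance Definition _ := Topological.copy baer_specker
  (prod_topology (fun _ : nat => discrete_topology int)).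

Lemma baer_specker_sub_continuous :
  continuous (fun x : baer_specker * baer_specker => x.1 - x.2).
Proof.
have projc i : continuous (fun x : baer_specker => x i : discrete_topology int).
  exact: (@proj_continuous nat (fun=> discrete_topology int) i).
move=> [x y]; apply/cvg_sup => i; apply/cvg_image.
  by apply/seteqP; split => // z _; exists (fun=> z).
move=> A /principal_filterP Axy.
exists [set g : baer_specker | A (g i)]; last first.
  apply/seteqP; split => [_ [g /= Ag <-]//|z Az].
  by exists (fun=> z).
exists ([set g : baer_specker | g i = x i], [set g : baer_specker | g i = y i]).
  split; [apply: (projc i x [set x i])|apply: (projc i y [set y i])];
    exact: (@discrete_set1 (discrete_topology int)).
move=> [g h] /= [gx hy].
by rewrite (_ : (g - h) i = (x - y) i) // -[LHS]/(g i - h i) gx hy.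
Qed.

HB.instance Definition _ := PreTopologicalNmodule_isTopologicalZmodule.Build
  baer_specker baer_specker_sub_continuous.

(* A subgroup is a [zmodClosed] predicate; this is its carrier type, equipped
   below with the induced group law and the subspace topology. *)
Definition subgroup (V : zmodType) (G : zmodClosed V) : Type :=
  {x : V | x \in G}.

HB.instance Definition _ (V : zmodType) (G : zmodClosed V) :=
  SubChoice.on (subgroup G).
HB.instance Definition _ (V : zmodType) (G : zmodClosed V) :=
  [SubChoice_isSubZmodule of subgroup G by <:].

Section SubgroupTopology.
Context (V : topologicalZmodType) (G : zmodClosed V).

HB.instance Definition _ := Topological.copy (subgroup G)
  (initial_topology (val : subgroup G -> V)).

Lemma subgroup_sub_continuous :
  continuous (fun x : subgroup G * subgroup G => x.1 - x.2).
Proof.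
have valc : continuous (val : subgroup G -> V) by exact: initial_continuous.
apply/continuousP => _ [A oA <-].
suff: open ((fun x : subgroup G * subgroup G => val x.1 - val x.2) @^-1` A).
  by congr open; apply/seteqP; split => x /=; rewrite GRing.valB.
move: A oA; apply/continuousP => x.
apply: (@continuous_comp _ _ _
  (fun x : subgroup G * subgroup G => (val x.1, val x.2))
  (fun x : V * V => x.1 - x.2)); last exact: sub_continuous.
apply: cvg_pair; apply: continuous_comp;
  by [exact: cvg_fst|exact: cvg_snd|exact: valc].
Qed.

HB.instance Definition _ := PreTopologicalNmodule_isTopologicalZmodule.Build
  (subgroup G) subgroup_sub_continuous.

End SubgroupTopology.

(* Main.v *)
(* The sets of [g] in [G] vanishing on an initial segment form a neighbourhood
   base at 0.  Modulo such a set an element is determined by its values on the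
   segment, so a finite set of translates of it is the same as a bound on those
   values; this links boundedness with the combinatorial conditions.  One bound
   then serves for infinitely many [n] by diagonalizing over the shifted
   functions [n |-> n + N].  Passing from the segments [0, n) back to [0, h n)
   replaces [n] by the largest [j] with [h j <= n] and [f] by its maximum over
   [0, h (j + 1)). *)
Require Import Defs.
From mathcomp Require Import all_boot all_order all_algebra.
From mathcomp Require Import all_classical all_reals all_analysis.
From mathcomp Require Import zify.

Set Implicit Arguments.
Unset Strict Implicit.
Unset Printing Implicit Defensive.

Import Order.TTheory GRing.Theory Num.Theory.

Local Open Scope classical_set_scope.
Local Open Scope ring_scope.

Lemma infinite_natP (A : set nat) :
  infinite_set A <-> forall N, exists2 n, (N <= n)%N & A n.
Proof.
split=> [infA N|unbA /finite_seqP[s As]].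
  have [n [An /negP]] : A `\` `I_N !=set0.
    by apply/infinite_setN0/infinite_setD => //; exact: finite_II.
  by rewrite -leqNgt => Nn; exists n.
have [n + An] := unbA (\max_(i <- s) i).+1.
have sn : n \in s by move: An; rewrite As.
by rewrite ltnNge (leq_bigmax_seq (F := id) _ sn).
Qed.

Lemma ltn_homo_leq (h : nat -> nat) n :
  {homo h : m n / (m < n)%N} -> (n <= h n)%N.
Proof.
by move=> hS; elim: n => // n IHn; exact: leq_ltn_trans IHn (hS _ _ (ltnSn n)).
Qed.

(** Segment lengths read off from arbitrary neighbourhoods need not be monotone, while the
    conditions quantify over strictly increasing functions only. Partial sums of positive terms
    bridge this gap. *)
Lemma exists_ltn_homo_ge (m : nat -> nat) :
  exists2 h : nat -> nat, {homo h : i j / (i < j)%N} & forall n, (m n <= h n)%N.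
Proof.
exists (fun n => \sum_(i < n.+1) (m i).+1)%N => [|n].
  apply: homo_ltn => [j i k|i]; first exact: ltn_trans.
  by rewrite [ltnRHS]big_ord_recr /= -addn1 leq_add2l.
by rewrite big_ord_recr /= -addSnnS leq_addl.
Qed.

(* Enlarging [F] by its opposites turns upper bounds into bounds on the
   absolute value. *)
Lemma finite_symmetrize (G : zmodClosed baer_specker) (F : set baer_specker) :
  finite_set F -> F `<=` [set` G] ->
  exists2 F' : set baer_specker, finite_set F' /\ F' `<=` [set` G] &
    forall m c, (forall g, F' g -> forall k, (k < m)%N -> g k <= c) ->
      forall g, F g -> forall k, (k < m)%N -> `|g k| <= c.
Proof.
move=> finF FG; exists (F `|` [set - g | g in F]).
  split; first by rewrite finite_setU; split => //; exact: finite_image.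
  by move=> _ [/FG//|[g /FG Gg <-]]; rewrite /= rpredN.
move=> m c F'c g Fg k km; rewrite ler_norml lerNl.
have -> := F'c g (or_introl Fg) k km; rewrite andbT.
by apply: (F'c (- g) _ k km); right; exists g.
Qed.

Lemma nbhs0_baer_specker (U : set baer_specker) :
  nbhs (0 : baer_specker) U <->
  exists m, [set g : baer_specker | forall k, (k < m)%N -> g k = 0] `<=` U.
Proof.
pose cyl m := [set g : baer_specker | forall k, (k < m)%N -> g k = 0].
split=> [|[m]]; last first.
  (* Lengthening the segment by one means intersecting with the preimage of [0] under one coordinate
     map, which is open since [int] is discrete. *)
  move=> /filterS; apply; elim: m => [|m IHm].
    by apply: (filterS _ filterT) => g _ k.
  have projc : continuous (fun x : baer_specker => x m : discrete_topology int).
    exact: (@proj_continuous nat (fun=> discrete_topology int) m).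
  have := projc (0 : baer_specker) [set 0 : int].
  move=> /(_ (@discrete_set1 (discrete_topology int) _)) nm.
  apply: filterS (filterI IHm nm) => g [/= gm g0] k.
  by rewrite ltnS leq_eqVlt => /predU1P[->|/gm].
have cylF : Filter (filter_from [set: nat] cyl).
  apply: filter_from_filter; first by exists 0%N.
  move=> i j _ _; exists (maxn i j) => // g gij.
  by split=> k kij; apply: gij; rewrite leq_max kij ?orbT.
suff cvgU : filter_from [set: nat] cyl --> (0 : baer_specker).
  by move=> /cvgU [m _ ?]; exists m.
(* The product topology is a supremum of initial topologies, so convergence is tested one coordinate
   at a time; a segment of length [i.+1] already fixes coordinate [i]. *)
apply/cvg_sup => i; apply/cvg_image.
  by apply/seteqP; split => // z _; exists (fun=> z).
move=> A /principal_filterP A0.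
exists [set g : baer_specker | A (g i)]; last first.
  apply/seteqP; split => [_ [g /= Ag <-]//|z Az].
  by exists (fun=> z).
by exists i.+1 => // g /(_ i (ltnSn i)) /= ->.
Qed.

Lemma nbhs0_subgroup (G : zmodClosed baer_specker) (U : set (subgroup G)) :
  nbhs (0 : subgroup G) U <->
  exists m, [set g : subgroup G | forall k, (k < m)%N -> val g k = 0] `<=` U.
Proof.
split=> [|[m mU]].
  rewrite nbhsE => -[_ [[B oB <-] B0] BU].
  have /nbhs0_baer_specker[m mB] : nbhs (0 : baer_specker) B.
    exact: open_nbhs_nbhs.
  by exists m => g /mB /BU.
have valc : continuous (val : subgroup G -> baer_specker).
  exact: initial_continuous.
apply: (filterS mU).
apply: (valc 0 [set g : baer_specker | forall k, (k < m)%N -> g k = 0]).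
by apply/nbhs0_baer_specker; exists m.
Qed.

Theorem theorem3p2 (G : zmodClosed baer_specker) :
  [<->
   (* 1 *)
   scheepers_bounded (subgroup G);
   (* 2 *)
   forall h : nat -> nat, {homo h : m n / (m < n)%N} ->
     exists f : nat -> nat,
     forall F : set baer_specker, finite_set F -> F `<=` [set` G] ->
     exists n, forall g, F g -> forall k, (k < h n)%N -> `|g k| <= (f n)%:Z;
   (* 3 *)
   forall h : nat -> nat, {homo h : m n / (m < n)%N} ->
     exists f : nat -> nat,
     forall F : set baer_specker, finite_set F -> F `<=` [set` G] ->
     exists n, forall g, F g -> forall k, (k < h n)%N -> g k <= (f n)%:Z;
   (* 4 *)
   exists f : nat -> nat,
     forall F : set baer_specker, finite_set F -> F `<=` [set` G] ->
     infinite_set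
       [set n | forall g, F g -> forall k, (k < n)%N -> `|g k| <= (f n)%:Z];
   (* 5 *)
   exists f : nat -> nat,
     forall F : set baer_specker, finite_set F -> F `<=` [set` G] ->
     infinite_set
       [set n | forall g, F g -> forall k, (k < n)%N -> g k <= (f n)%:Z];
   (* 2, infinitely many n *)
   forall h : nat -> nat, {homo h : m n / (m < n)%N} ->
     exists f : nat -> nat,
     forall F : set baer_specker, finite_set F -> F `<=` [set` G] ->
     infinite_set
       [set n | forall g, F g -> forall k, (k < h n)%N -> `|g k| <= (f n)%:Z];
   (* 3, infinitely many n *)
   forall h : nat -> nat, {homo h : m n / (m < n)%N} ->
     exists f : nat -> nat,
     forall F : set baer_specker, finite_set F -> F `<=` [set` G] ->
     infinite_set
       [set n | forall g, F g -> forall k, (k < h n)%N -> g k <= (f n)%:Z]].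
Proof.
tfae.
- move=> Gbnd h _.
  have [n|F [finF FG]] := Gbnd
    (fun n => [set g | forall k, (k < h n)%N -> val g k = 0]).
    by apply/nbhs0_subgroup; exists (h n).
  have /choice[f Ff] n : exists c, forall a, F n a ->
      forall k, (k < h n)%N -> (absz (val a k) <= c)%N.
    have /finite_seqP[s ->] := finF n.
    pose b (a : subgroup G) := (\max_(k < h n) absz (val a k))%N.
    exists (\max_(a <- s) b a)%N => a /= sa k kh.
    apply: leq_trans (leq_bigmax_seq (F := b) _ sa erefl).
    exact: (leq_bigmax (F := fun i : 'I_(h n) => absz (val a i)) (Ordinal kh)).
  exists f => A finA AG.
  (* Transport [A] into the carrier of the subgroup; the default [0] is never taken because [A] lies
     in [G]. *)
  have [n An] := FG _ (finite_image (insubd (0 : subgroup G)) finA).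
  exists n => g Ag k kh; have Gg := AG g Ag.
  have [a Fa [u u0 /(congr1 val)]] := An _ (ex_intro2 _ _ g Ag erefl).
  rewrite GRing.valD (insubdK _ Gg) => <-.
  rewrite -[X in `|X|]/(val a k + val u k) u0// addr0 -abszE lez_nat.
  exact: Ff.
- move=> H h /H[f fP]; exists f => F finF FG.
  have [n Fn] := fP F finF FG; exists n => g Fg k kh.
  by apply: le_trans (Fn g Fg k kh); exact: ler_norm.
- move=> H.
  have /choice[f fP] N := H (fun n => n + N)%N
    (fun m n mn => etrans (ltn_add2r N m n) mn).
  (* [f N] serves the shift by [N]. Only shifts [N <= n] enter the maximum, so the truncated
     subtraction is exact, and index [n + N] dominates [f N n]. *)
  exists (fun n => \max_(N < n.+1) f N (n - N))%N => F finF FG.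
  have [F' [finF' F'G] F'F] := finite_symmetrize finF FG.
  apply/infinite_natP => N; have [n F'n] := fP N F' finF' F'G.
  exists (n + N)%N; first exact: leq_addl.
  apply: F'F => g F'g k kn; apply: le_trans (F'n g F'g k kn) _.
  rewrite lez_nat; have Nn : (N < (n + N).+1)%N by rewrite ltnS leq_addl.
  have := leq_bigmax (F := fun i : 'I_(n + N).+1 => f i (n + N - i)%N)
    (Ordinal Nn).
  by rewrite /= addnK.
- move=> [f fP]; exists f => F finF FG.
  apply: sub_infinite_set (fP F finF FG) => n Fn g Fg k kn.
  by apply: le_trans (Fn g Fg k kn); exact: ler_norm.
- move=> [f fP] h hS; exists (fun n => \max_(i < h n.+1) f i)%N => F finF FG.
  have [F' [finF' F'G] F'F] := finite_symmetrize finF FG.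
  apply/infinite_natP => N.
  (* Taking [n] above [h N] makes [N] a candidate for [j], so the largest candidate is at least [N];
     candidates are bounded by [n] because [j <= h j]. *)
  have /infinite_natP/(_ (h N))[n hNn F'n] := fP F' finF' F'G.
  have [||j hjn jmax] := @ex_maxnP (fun j => h j <= n)%N n.
  + by exists N.
  + by move=> j; exact: leq_trans (ltn_homo_leq j hS).
  exists j; first exact: jmax.
  apply: F'F => g F'g k kj.
  apply: le_trans (F'n g F'g k (leq_trans kj hjn)) _; rewrite lez_nat.
  have nj : (n < h j.+1)%N.
    by rewrite ltnNge; apply/negP => /jmax; rewrite ltnn.
  exact: (leq_bigmax (F := fun i : 'I_(h j.+1) => f i) (Ordinal nj)).
- move=> H h /H[f fP]; exists f => F finF FG.
  apply: sub_infinite_set (fP F finF FG) => n Fn g Fg k kn.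
  by apply: le_trans (Fn g Fg k kn); exact: ler_norm.
- move=> H U /= U0.
  have /choice[m mU] n : exists m,
      [set g : subgroup G | forall k, (k < m)%N -> val g k = 0] `<=` U n.
    exact/nbhs0_subgroup.
  have [h hS mh] := exists_ltn_homo_ge m.
  have [f fP] := H h hS.
  (* A pattern [t] codes values between [-f n] and [f n], shifted by [f n] to become ordinals. There
     are finitely many patterns, and one representative of each gives the required finite set. *)
  pose agree n (t : {ffun 'I_(h n) -> 'I_(f n).*2.+1}) (a : subgroup G) :=
    forall k : 'I_(h n), val a k = (t k)%:Z - (f n)%:Z.
  (* Patterns realized by no element of [G] get the harmless default [0]. *)
  pose rep n t := xget (0 : subgroup G) (@agree n t).
  exists (fun n => range (rep n)); split=> [n|A finA].
    exact/finite_image/finite_finset.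
  have [|_ [a Aa <-]|F' [finF' F'G] F'A] := @finite_symmetrize G (val @` A).
  + exact: finite_image.
  + exact: valP.
  have /infinite_setN0[n F'n] := fP F' finF' F'G.
  exists n => a Aa.
  have an : forall k, (k < h n)%N -> `|val a k| <= (f n)%:Z.
    by apply: F'A F'n _ _; exists a.
  pose t := [ffun k : 'I_(h n) =>
    inord (absz (val a k + (f n)%:Z)) : 'I_(f n).*2.+1].
  have ta : agree n t a.
    move=> k; have := an k (ltn_ord k); rewrite ffunE.
    by move: (val a k : int) => x xf; rewrite inordK; lia.
  have trep : agree n t (rep n t) by apply: xgetPex; exists a.
  exists (rep n t); first by exists t.
  (* Both elements realize [t], so their difference vanishes below [h n], hence below [m n]. *)
  exists (a - rep n t); last by rewrite addrC subrK.
  apply: mU => k km; have kh := leq_trans km (mh n).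
  rewrite GRing.valB -[LHS]/(val a k - val (rep n t) k).
  by rewrite (ta (Ordinal kh)) (trep (Ordinal kh)) subrr.
Qed.
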